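(* For the cycle $C_n$ of order $n\geq 3$, $$\gamma_{tm}(C_n)=\begin{cases}4\lceil n/7\rceil-3 & \text{if } n\equiv 1 \pmod 7,\\ 4\lceil n/7\rceil-2 & \text{if } n\equiv 2,3 \pmod 7,\\ 4\lceil n/7\rceil-1 & \text{if } n\equiv 4 \pmod 7,\\ 4\lceil n/7\rceil & \text{if } n\equiv 0,5,6 \pmod 7.\end{cases}$$
   Context: $C_n$ is the cycle with $n$ vertices. A total mixed dominating set of a finite simple graph $G=(V,E)$ with minimum degree at least $1$ is a set $S\subseteq V\cup E$ such that every element of $V\cup E$ (including those in $S$) is adjacent or incident to an element of $S$ (two vertices are adjacent if joined by an edge; two distinct edges are adjacent if they share an endpoint; a vertex and an edge are incident if the vertex is an endpoint of the edge; no element is adjacent or incident to itself). The total mixed domination number $\gamma_{tm}(G)$ is the minimum cardinality of a total mixed dominating set. *)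

(* Defs.v *)
From mathcomp Require Import all_boot.

Set Implicit Arguments.
Unset Strict Implicit.
Unset Printing Implicit Defensive.

Record sgraph := SGraph {
  vertex : finType;
  adj : rel vertex;
  adj_sym : symmetric adj;
  adj_irrefl : irreflexive adj }.

Section TotalMixedDomination.
Variable G : sgraph.

Definition is_edge (E : {set vertex G}) : bool :=
  [exists x, exists y, adj x y && (E == [set x; y])].

Definition edge : finType := {E : {set vertex G} | is_edge E}.

Definition element : finType := (vertex G + edge)%type.

Definition min_degree_ge1 : Prop := forall x : vertex G, exists y, adj x y.

Definition adj_or_inc (a b : element) : bool :=
  match a, b with
  | inl x, inl y => adj x y
  | inl x, inr E => x \in val E
  | inr E, inl x => x \in val E
  | inr E, inr F => (E != F) && (val E :&: val F != set0)
  end.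

Definition total_mixed_dominating (S : {set element}) : bool :=
  [forall a : element, exists b in S, adj_or_inc a b].

(* The set of all elements is the starting point of the minimization; it is
   total mixed dominating when the minimum degree is at least 1. The value is
   meaningful only in that case, see [gamma_tmP]. *)
Definition gamma_tm : nat :=
  #|[arg min_(S < [set: element] | total_mixed_dominating S) #|S|]|.

Lemma total_mixed_dominatingT :
  min_degree_ge1 -> total_mixed_dominating [set: element].
Proof.
move=> deg1; apply/forallP => -[x|E].
  have [y xy] := deg1 x.
  by apply/existsP; exists (inl y); rewrite inE.
have /existsP[x /existsP[y /andP[_ /eqP defE]]] := valP E.
apply/existsP; exists (inl x); rewrite inE /=.
by rewrite defE !inE eqxx.
Qed.

Lemma gamma_tmP : min_degree_ge1 ->
  (exists2 S, total_mixed_dominating S & #|S| = gamma_tm) /\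
  (forall S, total_mixed_dominating S -> gamma_tm <= #|S|).
Proof.
move=> /total_mixed_dominatingT domT; rewrite /gamma_tm.
by case: arg_minnP => // S domS minS; split=> //; exists S.
Qed.

End TotalMixedDomination.

Section Cycle.
Variable n : nat.

(* The condition [i != j] only matters for n = 1, where [ordS i = i]. *)
Definition cycle_adj (i j : 'I_n) : bool :=
  (i != j) && ((j == ordS i) || (i == ordS j)).

Lemma cycle_adj_sym : symmetric cycle_adj.
Proof. by move=> i j; rewrite /cycle_adj eq_sym orbC. Qed.

Lemma cycle_adj_irrefl : irreflexive cycle_adj.
Proof. by move=> i; rewrite /cycle_adj eqxx. Qed.

Definition cycle_graph : sgraph := SGraph cycle_adj_sym cycle_adj_irrefl.

Lemma cycle_graph_min_degree : 3 <= n -> min_degree_ge1 cycle_graph.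
Proof.
move=> n3 i; exists (ordS i); rewrite /= /cycle_adj eqxx andbT -val_eqE /=.
have := ltn_ord i; rewrite leq_eqVlt => /predU1P[ein|lt_in].
  by rewrite ein modnn -lt0n -ltnS ein ltnW.
by rewrite modn_small // neq_ltn ltnSn.
Qed.

End Cycle.

Definition ceil_div (m d : nat) : nat := m %/ d + ~~ (d %| m).

(* Main.v *)
Require Import Defs.
From mathcomp Require Import all_boot.
From mathcomp Require Import zify.

Set Implicit Arguments.
Unset Strict Implicit.
Unset Printing Implicit Defensive.

(** List the elements of C_n in the order in which one meets them when walking
around the cycle: vertex, edge, vertex, edge, ... Two elements are adjacent or
incident exactly when they are one or two steps apart in this list
([adj_or_inc_elt]), so the total graph of C_n is the square of a cycle with
N = 2n points, and gamma_tm(C_n) is the total domination number of that square.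

Lower bound ([square_dominating_card]). Let S be total dominating, s = #|S|, and
look at the gaps between cyclically consecutive members of S. A gap is at most
5, since a gap of 6 or more contains a point at distance at least 3 from S.
Two gaps larger than 2 are never consecutive, since the member of S between
them would be undominated; hence at most s/2 gaps are larger than 2. The gaps
add up to N, so 2n <= 2s + 3 floor(s/2).

Upper bound ([path_bound_cycle_gamma]). On a line, the points 2 and 4 dominate
0, ..., 6, themselves included. Copies of this pattern placed side by side use
2 points for every 7, that is 4 points for every 7 vertices of C_n; a short ad
hoc pattern takes care of the residue of n modulo 7. The image of the pattern
under the walk around the cycle is a total mixed dominating set.

The two bounds agree for every n >= 3. Rounding down s/2 is what makes them meet
when n = 5 modulo 7, where 2n <= 7s/2 alone would allow one element fewer. *)

(** * Total domination in the square of a cycle *)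

Section SquareOfPermutation.
Variables (T : finType) (f : T -> T).

(** [f] is thought of as the successor map of a cycle; when it is a permutation
with several cycles, this is the square of their disjoint union. *)
Definition square_adj (p q : T) : bool :=
  [|| q == f p, q == f (f p), p == f q | p == f (f q)].

Definition square_dominating (S : {set T}) : Prop :=
  forall p, exists2 q, q \in S & square_adj p q.

Definition long_gap_starts (S : {set T}) : {set T} :=
  [set p in S | (f p \notin S) && (f (f p) \notin S)].

Hypothesis f_inj : injective f.

(** A member of [S] followed by a large gap is dominated from behind, and its
dominator is followed by a gap of at most 2. Sending each gap start to its
nearest dominator thus gives an injection of the gap starts into the other
members of [S]. *)
Lemma card_long_gap_starts (S : {set T}) :
  square_dominating S -> #|long_gap_starts S| <= #|S|./2.
Proof.
move=> domS; have [g fK gK] := injF_bij f_inj.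
pose h p := if g p \in S then g p else g (g p).
have h_notin p : p \in long_gap_starts S -> h p \in S :\: long_gap_starts S.
  rewrite !inE => /and3P[pS fpS ffpS]; rewrite /h.
  case: ifPn => gpS; first by rewrite gpS gK pS.
  have [q qS /or4P[]/eqP pq] := domS p.
  - by rewrite -pq qS in fpS.
  - by rewrite -pq qS in ffpS.
  - by rewrite pq fK qS in gpS.
  - by rewrite pq !fK qS -pq pS andbF.
have h_inj : {in long_gap_starts S &, injective h}.
  (* The nearest dominators of p and p' can only coincide at different distances
     if p' is the successor of p, which would make the gap after p equal to 1. *)
  have skip p p' : p \in long_gap_starts S -> p' \in long_gap_starts S ->
      g p <> g (g p').
    rewrite !inE => /and3P[_ fpS _] /andP[p'S _] /(congr1 f); rewrite !gK => e.
    by rewrite e gK p'S in fpS.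
  have g_inj : injective g := can_inj gK.
  move=> p p' pB p'B; rewrite /h; case: ifP => _; case: ifP => _.
  - exact: g_inj.
  - by move/(skip _ _ pB p'B).
  - by move/esym/(skip _ _ p'B pB).
  - by move/g_inj/g_inj.
have hB : h @: long_gap_starts S \subset S :\: long_gap_starts S.
  by apply/subsetP => _ /imsetP[p pB ->]; apply: h_notin.
have := subset_leq_card hB; rewrite card_in_imset //.
have BS : long_gap_starts S \subset S.
  by apply/subsetP => p; rewrite inE => /andP[].
by rewrite cardsDS //; have := subset_leq_card BS; lia.
Qed.

(** Every point lies one or two steps after some member of [S], or three to
five steps after a member of [S] that starts a large gap; five is the most
because the middle of the gap has to be dominated. *)
Lemma square_dominating_card (S : {set T}) :
  square_dominating S -> #|T| <= 2 * #|S| + 3 * #|S|./2.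
Proof.
move=> domS; have [g fK gK] := injF_bij f_inj.
have leB := card_long_gap_starts domS.
set B := long_gap_starts S in leB.
have cover : [set: T] \subset
    f @: S :|: f @: (f @: S) :|:
    (f @: (f @: (f @: B)) :|: f @: (f @: (f @: (f @: B))) :|:
     f @: (f @: (f @: (f @: (f @: B))))).
  have memf p (A : {set T}) : (p \in f @: A) = (g p \in A).
    by rewrite -{1}[p]gK mem_imset.
  apply/subsetP => p _; rewrite !inE !memf !inE !gK.
  case: (boolP (g p \in S)) => //= S1; case: (boolP (g (g p) \in S)) => //= S2.
  case: (boolP (g (g (g p)) \in S)) => //= S3.
  case: (boolP (g (g (g (g p))) \in S)) => //= S4.
  (* None of the four points before p is in S; the point three steps back is
     dominated, and only the point five steps before p is left for that. *)
  have [q qS /or4P[]/eqP e] := domS (g (g (g p))).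
  - by move: qS; rewrite e gK (negbTE S2).
  - by move: qS; rewrite e !gK (negbTE S1).
  - by rewrite e !fK qS in S4.
  - by rewrite e !fK qS.
have leU a b (A A' : {set T}) : #|A| <= a -> #|A'| <= b -> #|A :|: A'| <= a + b.
  move=> leA leA'; apply: leq_trans (leq_add leA leA').
  exact: (leq_card_setU A A').
apply: (@leq_trans (#|S| + #|S| + (#|B| + #|B| + #|B|))); last lia.
rewrite -cardsT; apply: leq_trans (subset_leq_card cover) _.
by rewrite !leU ?card_imset.
Qed.

End SquareOfPermutation.

(** * Dominating patterns on a line *)

Definition near (p q : nat) : bool := [&& p != q, p <= q + 2 & q <= p + 2].

(** The entries of [s] may exceed [m]: only the points below [m] have to be
dominated. *)
Definition path_dominating (m : nat) (s : seq nat) : bool :=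
  all (fun p => has (near p) s) (iota 0 m).

Lemma path_dominatingP m s :
  reflect (forall p, p < m -> exists2 q, q \in s & near p q)
          (path_dominating m s).
Proof.
apply: (iffP allP) => domS p.
  by move=> pm; apply/hasP/domS; rewrite mem_iota.
by rewrite mem_iota => pm; apply/hasP/domS.
Qed.

Lemma path_dominating_cat m1 s1 m2 s2 :
  path_dominating m1 s1 -> path_dominating m2 s2 ->
  path_dominating (m1 + m2) (s1 ++ map (addn m1) s2).
Proof.
move=> /path_dominatingP dom1 /path_dominatingP dom2.
apply/path_dominatingP => p pm; case: (ltnP p m1) => pm1.
  by have [q qs pq] := dom1 p pm1; exists q; rewrite // mem_cat qs.
have [|q qs pq] := dom2 (p - m1); first lia.
exists (m1 + q); first by rewrite mem_cat map_f ?orbT.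
by move: pq; rewrite /near; lia.
Qed.

Definition path_bound (m k : nat) : Prop :=
  exists2 s, path_dominating m s & size s = k.

Lemma path_bound_add m1 k1 m2 k2 :
  path_bound m1 k1 -> path_bound m2 k2 -> path_bound (m1 + m2) (k1 + k2).
Proof.
move=> [s1 dom1 <-] [s2 dom2 <-]; exists (s1 ++ map (addn m1) s2).
  exact: path_dominating_cat.
by rewrite size_cat size_map.
Qed.

Lemma path_bound_mul j m k : path_bound m k -> path_bound (j * m) (j * k).
Proof.
move=> mk; elim: j => [|j IHj]; first by exists [::].
by rewrite !mulSn; apply: path_bound_add.
Qed.

(** The four cases of the theorem in one formula: the value grows by 4 when [n]
grows by 7. *)
Definition cycle_gamma (n : nat) : nat :=
  4 * (n %/ 7) + nth 0 [:: 0; 1; 2; 2; 3; 4; 4] (n %% 7).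

(** Two copies of the 7-point pattern cover 14 points of the line, that is 7
vertices and 7 edges of the cycle. For n = 1 modulo 7 the 2 remaining points
cannot be dominated by a single point of their own block, so the last 14 points
are merged with them into a block of 16; this is where n > 1 is used. *)
Lemma path_bound_cycle_gamma n : 3 <= n -> path_bound n.*2 (cycle_gamma n).
Proof.
move=> n3; rewrite /cycle_gamma.
have b7 : path_bound 7 2 by exists [:: 2; 4].
have bound m k j : path_bound m k -> n.*2 = j * 14 + m ->
    path_bound n.*2 (4 * j + k).
  move=> mk ->; have := path_bound_add (path_bound_mul j.*2 b7) mk.
  by congr path_bound; lia.
have := ltn_pmod n (isT : 0 < 7); have := divn_eq n 7.
case: (n %% 7) => [|[|[|[|[|[|[|//]]]]]]] e _ /=.
- by apply: (@bound 0); [exists [::] | lia].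
- have -> : 4 * (n %/ 7) + 1 = 4 * (n %/ 7 - 1) + 5 by lia.
  by apply: (@bound 16); [exists [:: 2; 4; 9; 11; 13] | lia].
- by apply: (@bound 4); [exists [:: 2; 3] | lia].
- by apply: (@bound 6); [exists [:: 2; 3] | lia].
- by apply: (@bound 8); [exists [:: 2; 4; 5] | lia].
- by apply: (@bound 10); [exists [:: 2; 4; 8; 9] | lia].
- by apply: (@bound 12); [exists [:: 2; 4; 8; 9] | lia].
Qed.

Lemma near_iter (T : finType) (f : T -> T) x p q :
  near p q -> square_adj f (iter p f x) (iter q f x).
Proof.
rewrite /near /square_adj => pq.
have : [|| q == p.+1, q == p.+2, p == q.+1 | p == q.+2] by lia.
by case/or4P => /eqP-> /=; rewrite eqxx ?orbT.
Qed.

(** * The total graph of a cycle *)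

Section CycleElements.
Variables (n : nat) (n_ge3 : 3 <= n).
Notation C := (cycle_graph n).

Lemma ordS_neq (i : 'I_n) : (ordS i == i) = false.
Proof.
apply/eqP => /(congr1 val) /=; have := ltn_ord i; rewrite leq_eqVlt.
by case/predU1P => [e|lt_in]; [rewrite e modnn; lia | rewrite modn_small; lia].
Qed.

(** This is where the absence of 2-cycles enters: it makes the edges
{i, i+1} pairwise distinct. *)
Lemma ordSS_neq (i : 'I_n) : (ordS (ordS i) == i) = false.
Proof.
apply/eqP => /(congr1 val) /=; have := ltn_ord i; rewrite leq_eqVlt.
case/predU1P => [e|]; first by rewrite e modnn modn_small; lia.
rewrite leq_eqVlt => /predU1P[e|lt_in]; last by rewrite !modn_small; lia.
by rewrite (@modn_small i.+1) ?e ?modnn; lia.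
Qed.

Lemma cycle_edge_subproof (i : 'I_n) :
  is_edge ([set i; ordS i] : {set vertex C}).
Proof.
apply/existsP; exists i; apply/existsP; exists (ordS i).
by rewrite /= /cycle_adj eq_sym ordS_neq !eqxx.
Qed.

Definition cycle_edge (i : 'I_n) : edge C := Sub _ (cycle_edge_subproof i).

(** Positions on the walk around the cycle: [inl i] is the i-th vertex and
[inr i] the edge leaving it. This indexing makes the successor map
[half_step] definable without arithmetic modulo 2n. *)
Definition elt (p : 'I_n + 'I_n) : element C :=
  match p with inl i => inl i | inr i => inr (cycle_edge i) end.

Definition half_step (p : 'I_n + 'I_n) : 'I_n + 'I_n :=
  match p with inl i => inr i | inr i => inl (ordS i) end.

Lemma ordS_injective : injective (@ordS n).
Proof. exact: can_inj (@ordSK n). Qed.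

Lemma half_step_inj : injective half_step.
Proof.
move=> [i|i] [j|j] //= e; first by case: e => ->.
by rewrite (ordS_injective (inl_inj e)).
Qed.

Lemma cycle_edge_inj : injective cycle_edge.
Proof.
move=> i j /(congr1 val) /= /setP eij.
have := eij i; have := eij (ordS i); rewrite !inE !eqxx orbT /=.
case/esym/orP => /eqP ei; last by move/ordS_injective: ei.
case/esym/orP => /eqP ej //.
by have := ordSS_neq j; rewrite -ej ei eqxx.
Qed.

Lemma elt_inj : injective elt.
Proof.
move=> [i|i] [j|j] //= e; first by case: e => ->.
by rewrite (cycle_edge_inj (inr_inj e)).
Qed.

Lemma elt_surj (a : element C) : exists p, elt p = a.
Proof.
case: a => [i|E]; first by exists (inl i).
have /existsP[i /existsP[j /andP[/andP[_ ij] /eqP defE]]] := valP E.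
case/orP: ij => /eqP e; [exists (inr i) | exists (inr j)];
  by congr inr; apply: val_inj; rewrite /= defE e // setUC.
Qed.

Lemma adj_or_inc_elt p q :
  adj_or_inc (elt p) (elt q) = square_adj half_step p q.
Proof.
have inj_inl := inj_eq (@inl_inj 'I_n 'I_n).
have inj_inr := inj_eq (@inr_inj 'I_n 'I_n).
case: p q => [i|i] [j|j]; rewrite /square_adj /= ?inj_inl ?inj_inr /= ?orbF.
- rewrite /cycle_adj; case: (altP (i =P j)) => [->|//] /=.
  by rewrite eq_sym ordS_neq.
- by rewrite !inE eq_sym.
- by rewrite !inE orbC (eq_sym i).
rewrite (inj_eq cycle_edge_inj); case: (altP (i =P j)) => [->|ij] /=.
  by rewrite eq_sym ordS_neq.
apply/set0Pn/orP => [[k]|].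
  rewrite !inE => /andP[/orP[]/eqP-> /orP[]/eqP e].
  - by rewrite e eqxx in ij.
  - by right; rewrite e.
  - by left; rewrite e.
  - by rewrite (ordS_injective e) eqxx in ij.
by case=> /eqP->; [exists (ordS i) | exists (ordS j)]; rewrite !inE !eqxx !orbT.
Qed.

(** The walk is a single cycle, so a pattern on the line 0, ..., 2n-1 wraps
onto all positions. *)
Lemma half_step_iter (p : 'I_n + 'I_n) (x0 : 'I_n) :
  val x0 = 0 -> exists2 k, k < n.*2 & p = iter k half_step (inl x0).
Proof.
move=> x00.
have even k (kn : k < n) : inl (Ordinal kn) = iter k.*2 half_step (inl x0).
  elim: k kn => [|k IHk] kn; first by congr inl; apply: val_inj.
  rewrite doubleS !iterS -(IHk (ltnW kn)) /=.
  by congr inl; apply: val_inj; rewrite /= modn_small.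
case: p => [[i lt_in]|[i lt_in]]; [exists i.*2 | exists i.*2.+1]; try lia.
  exact: even.
by rewrite iterS -even.
Qed.

(** Wrapping a line around the cycle preserves nearness, and points with the
same image can only make the dominating set smaller. *)
Lemma gamma_tm_upper k : path_bound n.*2 k -> gamma_tm C <= k.
Proof.
case=> s /path_dominatingP domS <-.
have [_ minS] := gamma_tmP (cycle_graph_min_degree n_ge3).
pose x0 := Ordinal (leq_trans (isT : 0 < 3) n_ge3).
pose pos k := elt (iter k half_step (inl x0)).
apply: (@leq_trans #|[set a in map pos s]|); last first.
  by rewrite cardsE (leq_trans (card_size _)) ?size_map.
apply: minS; apply/forallP => a; have [p <-] := elt_surj a.
have [j jn ->] := half_step_iter p (erefl (val x0)).
have [q qs jq] := domS j jn.
apply/existsP; exists (pos q).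
by rewrite inE map_f //= adj_or_inc_elt near_iter.
Qed.

Lemma gamma_tm_lower : n.*2 <= 2 * gamma_tm C + 3 * (gamma_tm C)./2.
Proof.
have [[S /forallP domS <-] _] := gamma_tmP (cycle_graph_min_degree n_ge3).
have domS' : square_dominating half_step (elt @^-1: S).
  move=> p; have /existsP[b /andP[bS pb]] := domS (elt p).
  have [q defb] := elt_surj b.
  by exists q; [rewrite inE defb | rewrite -adj_or_inc_elt defb].
have cardS : #|elt @^-1: S| <= #|S|.
  rewrite -(card_imset _ elt_inj); apply: subset_leq_card.
  by apply/subsetP => _ /imsetP[p + ->]; rewrite inE.
have := square_dominating_card half_step_inj domS'.
by rewrite card_sum card_ord; lia.
Qed.

Lemma gamma_tm_cycle : gamma_tm C = cycle_gamma n.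
Proof.
have := gamma_tm_upper (path_bound_cycle_gamma n_ge3); have := gamma_tm_lower.
rewrite /cycle_gamma; have := ltn_pmod n (isT : 0 < 7); have := divn_eq n 7.
case: (n %% 7) => [|[|[|[|[|[|[|//]]]]]]] e _ /=; lia.
Qed.

End CycleElements.

Theorem proposition3p2 (n : nat) (hn : 3 <= n) :
  [/\ n = 1 %[mod 7] ->
        gamma_tm (cycle_graph n) = 4 * ceil_div n 7 - 3,
      n = 2 %[mod 7] \/ n = 3 %[mod 7] ->
        gamma_tm (cycle_graph n) = 4 * ceil_div n 7 - 2,
      n = 4 %[mod 7] ->
        gamma_tm (cycle_graph n) = 4 * ceil_div n 7 - 1
    & [\/ n = 0 %[mod 7], n = 5 %[mod 7] | n = 6 %[mod 7]] ->
        gamma_tm (cycle_graph n) = 4 * ceil_div n 7].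
Proof.
rewrite gamma_tm_cycle // /cycle_gamma /ceil_div /dvdn.
split=> [->|[]->|->|[]->] /=; lia.
Qed.
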